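(* Let $G$ be a finite simple graph on $n$ vertices with at least one edge, and let $\lambda_{2}$ and $\lambda_{n}$ be the second smallest and the largest Laplacian eigenvalues of $G$, respectively. Then \[ \mathrm{tw}(G) \ge \frac{2n \lambda_{2}}{3\lambda_{n} - \lambda_{2}} - 1, \] where $\mathrm{tw}(G)$ is the treewidth of $G$.
   Context: For a graph $G=(V,E)$ with $n$ vertices, the Laplacian matrix $L \in \mathbb{Z}^{V\times V}$ is given by $L(u,u)=\deg(u)$, $L(u,v)=-1$ if $\{u,v\}\in E$, and $L(u,v)=0$ otherwise (for $u \ne v$). The Laplacian eigenvalues are the eigenvalues of $L$, listed in non-decreasing order as $\lambda_1 \le \lambda_2 \le \dots \le \lambda_n$. Treewidth is the standard notion: the minimum, over all tree decompositions of $G$, of the maximum bag size minus one. *)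

(* Defs.v *)
From HB Require Import structures.
From mathcomp Require Import all_boot all_order all_algebra.
From mathcomp Require Import reals.
From Stdlib Require Import ClassicalEpsilon.
Set Implicit Arguments. Unset Strict Implicit. Unset Printing Implicit Defensive.
Import Order.TTheory GRing.Theory Num.Theory.

Definition simple_graph n (e : rel 'I_n) : Prop :=
  symmetric e /\ irreflexive e.

Definition laplacian (R : pzRingType) n (e : rel 'I_n) : 'M[R]_n :=
  \matrix_(i, j) (if i == j then (#|[set k | e i k]|)%:R
                  else if e i j then -1 else 0)%R.

Definition lap_spectrum (R : realType) n (e : rel 'I_n) (s : seq R) : Prop :=
  sorted <=%R s /\
  char_poly (laplacian R e) = (\prod_(x <- s) ('X - x%:P))%R.

(* A (finite) tree on node set 'I_m: symmetric, irreflexive, connected,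
   with exactly m-1 (unordered) edges. *)
Definition is_tree m (t : rel 'I_m) : Prop :=
  [/\ 0 < m, symmetric t, irreflexive t,
      (forall a b, connect t a b) &
      #|[set p : 'I_m * 'I_m | t p.1 p.2]| = (m.-1).*2].

Definition tree_decomposition n (e : rel 'I_n) m (t : rel 'I_m)
    (bag : 'I_m -> {set 'I_n}) : Prop :=
  [/\ is_tree t,
      (forall v, exists a, v \in bag a),
      (forall u v, e u v -> exists a, (u \in bag a) && (v \in bag a)) &
      (forall v a b, v \in bag a -> v \in bag b ->
         connect [rel x y | [&& t x y, v \in bag x & v \in bag y]] a b)].

Definition has_td_width_le n (e : rel 'I_n) (k : nat) : Prop :=
  exists m (t : rel 'I_m) (bag : 'I_m -> {set 'I_n}),
    tree_decomposition e t bag /\ forall a, #|bag a| <= k.+1.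

Definition treewidth n (e : rel 'I_n) : nat :=
  epsilon (inhabits 0%N)
    (fun k => has_td_width_le e k /\ forall j, has_td_width_le e j -> k <= j).

(* Main.v *)
Require Import Defs.
From HB Require Import structures.
From mathcomp Require Import all_boot all_order all_algebra.
From mathcomp Require Import reals zify ring lra.
From mathcomp Require Import sesquilinear spectral complex.
From Stdlib Require Import Classical ClassicalEpsilon.
Import Order.TTheory GRing.Theory Num.Theory.
Set Implicit Arguments. Unset Strict Implicit. Unset Printing Implicit Defensive.

(* Put w = tw(G) + 1 and assume w < n. Some X with |X| <= w splits V \ X into
   two sides A and B, not joined by an edge, with |A| <= 2|B| and |B| <= 2|A|.
   Otherwise every separation of order at most w has exactly one small side,
   and contracting the leaves of the decomposition tree one by one shows that
   everything hanging off each remaining bag is small; this is absurd once a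
   single bag remains.

   As no edge joins A to B, the vectors 1_A - 1_B and 1_A + 1_B have the same
   Laplacian energy. Bounding it from below by lambda_2 on the first and from
   above by lambda_n on the second, after subtracting the means, gives with
   m = |A| + |B|
     lambda_2 (m n - (|A| - |B|)^2) <= lambda_n m |X|.
   The balance condition says 9 (|A| - |B|)^2 <= m^2, whence
   lambda_2 (8 n + |X|) <= 9 lambda_n |X|, which is more than needed. *)

(** * Balanced separations from tree decompositions *)

(** Connectedness of the subgraph induced on [D], stated by cuts rather than paths. This form
    survives the deletion of a leaf without any surgery on paths. *)
Definition cut_connected (T : finType) (t : rel T) (D : {set T}) : Prop :=
  forall S : {set T}, S \subset D -> S != set0 -> S != D ->
  exists x y, [/\ x \in S, y \in D, y \notin S & t x y].

Definition arcs (T : finType) (t : rel T) (D : {set T}) : {set T * T} :=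
  [set p | [&& p.1 \in D, p.2 \in D & t p.1 p.2]].

Lemma connect_cut_connected (T : finType) (t : rel T) (D : {set T}) :
  (forall a b, a \in D -> b \in D ->
     connect [rel x y | [&& t x y, x \in D & y \in D]] a b) ->
  cut_connected t D.
Proof.
move=> con S sSD /set0Pn[a aS] neSD.
have [b bD bNS] : exists2 b, b \in D & b \notin S.
  by apply/subsetPn; apply: contra neSD => sDS; rewrite eqEsubset sSD.
have /connectP[p pth bE] := con a b (subsetP sSD a aS) bD.
elim: p a aS pth bE => [a aS _ bE|c p IH a aS /= /andP[/and3P[tac _ cD] pth] bE].
  by rewrite bE aS in bNS.
have [cS|cNS] := boolP (c \in S); first exact: IH cS pth bE.
by exists a, c.
Qed.

(** If [p] lies in [S], apply the hypothesis to [S] together with [l]: the crossing edge cannot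
    start at [l], whose only neighbour is already inside. If [p] lies outside, the crossing edge out
    of [S] cannot end at [l]. The case where [l] is not in [D] serves for the nodes whose bags hold
    a given vertex. *)
Lemma cut_connectedD1 (T : finType) (t : rel T) (D : {set T}) (l p : T) :
  symmetric t -> (forall y, y \in D -> t l y -> y = p) ->
  cut_connected t D -> cut_connected t (D :\ l).
Proof.
move=> tsym leaf con S sSD S0 SD.
have lNS : l \notin S by apply/negP => /(subsetP sSD); rewrite !inE eqxx.
have sSD' : S \subset D by apply: subset_trans sSD (subsetDl _ _).
have [lD|lND] := boolP (l \in D); last first.
  have DE : D :\ l = D.
    by apply/setP => x; rewrite !inE; case: eqP => // ->; rewrite (negPf lND).
  by rewrite DE in SD *; apply: con.
have [pS|pNS] := boolP (p \in S).
- have /con : l |: S \subset D by rewrite subUset sub1set lD.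
  case=> [||x [y [xS yD yS txy]]].
  + by apply/set0Pn; exists l; rewrite setU11.
  + by apply: contra SD => /eqP <-; rewrite setU1K.
  move: xS yS; rewrite !inE negb_or => /orP[/eqP xE|xS] /andP[yl yNS].
    by rewrite xE in txy; rewrite (leaf y yD txy) pS in yNS.
  by exists x, y; rewrite !inE yl.
- have SneD : S != D by apply: contraNneq lNS => ->.
  have [x [y [xS yD yNS txy]]] := con S sSD' S0 SneD.
  exists x, y; split => //; rewrite !inE yD andbT.
  apply: contraNneq pNS => yl; rewrite yl tsym in txy.
  by rewrite -(leaf x (subsetP sSD' x xS) txy).
Qed.

Lemma card_arcs (T : finType) (t : rel T) (D : {set T}) :
  #|arcs t D| = \sum_(x in D) #|[set y in D | t x y]|.
Proof.
rewrite -sum1_card (eq_bigl (fun p : T * T => (p.1 \in D) && ((p.2 \in D) && t p.1 p.2)));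
  last by move=> p; rewrite inE.
rewrite -(pair_big_dep (fun x => x \in D) (fun x y => (y \in D) && t x y) (fun _ _ => 1)).
by apply: eq_bigr => x _; rewrite sum1_card; apply: eq_card => y; rewrite !inE.
Qed.

(** Were all degrees at least 2, there would be at least [2 |D|] arcs, each edge being counted in
    both directions. The cut around a node of degree at most 1 then yields its neighbour. *)
Lemma exists_leaf (T : finType) (t : rel T) (D : {set T}) :
  symmetric t -> irreflexive t -> cut_connected t D -> 1 < #|D| ->
  #|arcs t D| <= (#|D|.-1).*2 ->
  exists l p, [/\ l \in D, p \in D, p != l, t l p &
    forall y, y \in D -> t l y -> y = p].
Proof.
move=> tsym tirr con D2 arcsD.
have [l lD degl] : exists2 l, l \in D & #|[set y in D | t l y]| <= 1.
  apply/exists_inP; rewrite -[X in is_true X]negbK negb_exists_in.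
  apply/negP => /forall_inP deg2.
  suff : #|D| * 2 <= #|arcs t D| by lia.
  rewrite card_arcs -sum_nat_const; apply: leq_sum => x /deg2; lia.
have [|||x [p [/set1P-> pD pl tlp]]] := con [set l].
- by rewrite sub1set.
- by apply/set0Pn; exists l; rewrite set11.
- by apply: contraTneq D2 => <-; rewrite cards1.
exists l, p; split=> //; first by rewrite in_set1 in pl.
by move=> y yD tly; apply: (card_le1_eqP degl); rewrite inE ?yD ?pD.
Qed.

Lemma card_arcsD1 (T : finType) (t : rel T) (D : {set T}) (l p : T) :
  symmetric t -> l \in D -> p \in D -> p != l -> t l p ->
  #|arcs t (D :\ l)| + 2 <= #|arcs t D|.
Proof.
move=> tsym lD pD pl tlp.
have <- : #|[set (l, p); (p, l)]| = 2.
  by rewrite cards2 xpair_eqE eq_sym (negPf pl).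
rewrite -cardsUI (_ : arcs t (D :\ l) :&: _ = set0) ?cards0 ?addn0.
  apply: subset_leq_card; apply/subsetP => -[x y]; rewrite !inE /=.
  case/or3P => [/and3P[/andP[_ ->] /andP[_ ->] ->] //|/eqP[-> ->]|/eqP[-> ->]].
    by rewrite lD pD.
  by rewrite lD pD tsym.
apply/setP => -[x y]; rewrite !inE /= !xpair_eqE.
by case: (x =P l); case: (y =P l); rewrite /= ?andbF.
Qed.

(** * Separations and their small sides *)

Lemma exists_subset_card (V : finType) (Y : {set V}) k :
  k <= #|Y| -> exists2 Z : {set V}, Z \subset Y & #|Z| = k.
Proof.
move=> kY; exists [set x in take k (enum Y)].
  by apply/subsetP => x; rewrite inE => /mem_take; rewrite mem_enum.
rewrite cardsE (card_uniqP _) ?take_uniq ?enum_uniq // size_take -cardE.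
by case: ltngtP kY.
Qed.

Definition separation (V : finType) (e : rel V) (A X : {set V}) : Prop :=
  [disjoint A & X] /\ forall u v, u \in A -> e u v -> v \in A :|: X.

Definition far_side (V : finType) (A X : {set V}) : {set V} := ~: (A :|: X).

(* Under this hypothesis the side A of a separation is small when
   2 |A| < |far_side A X|. *)
Definition unbalanced (V : finType) (e : rel V) (w : nat) : Prop :=
  forall A X : {set V}, separation e A X -> #|X| <= w ->
  2 * #|A| < #|far_side A X| \/ 2 * #|far_side A X| < #|A|.

Lemma card_separation (V : finType) (A X : {set V}) : [disjoint A & X] ->
  #|A| + #|X| + #|far_side A X| = #|V|.
Proof.
rewrite -setI_eq0 => /eqP dAX; rewrite -(cardsUI A X).
by rewrite dAX cards0 addn0 cardsC.
Qed.

(* If the grown side were not small, absorbing only as many vertices as needed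
   would make both sides equal. *)
Lemma small_side_absorb (V : finType) (e : rel V) w (A X Y : {set V}) :
  unbalanced e w -> separation e A X -> #|X| <= w -> Y \subset X ->
  (forall u v, u \in Y -> e u v -> v \in A :|: X) ->
  2 * #|A| < #|far_side A X| ->
  2 * #|A :|: Y| < #|far_side (A :|: Y) (X :\: Y)|.
Proof.
move=> unb [dAX nA] Xw sYX nY small.
have far (Z : {set V}) : Z \subset X -> A :|: Z :|: (X :\: Z) = A :|: X.
  by move=> sZX; rewrite -setUA -{2}(setID X Z) (setIidPr sZX).
have crd (Z : {set V}) : Z \subset X -> #|A :|: Z| = #|A| + #|Z|.
  move=> sZX; rewrite -cardsUI (_ : A :&: Z = set0) ?cards0 ?addn0 //.
  by apply/eqP; rewrite setI_eq0; apply: disjointWr dAX.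
have sep (Z : {set V}) : Z \subset Y -> separation e (A :|: Z) (X :\: Z) /\ #|X :\: Z| <= w.
  move=> sZY; have sZX := subset_trans sZY sYX; split; last first.
    exact: leq_trans (subset_leq_card (subsetDl _ _)) Xw.
  split.
    rewrite -setI_eq0 setIUl setU_eq0 !setI_eq0 (disjointWr (subsetDl _ _)) //=.
    by rewrite disjoints_subset; apply/subsetP => x; rewrite !inE => ->.
  move=> u v; rewrite far // inE => /orP[/nA|/(subsetP sZY) /nY]; exact.
rewrite /far_side far // -/(far_side A X) crd // ltnNge; apply/negP => big.
have [|Z sZY cZ] := @exists_subset_card _ Y (#|far_side A X| - #|A|).
  have [s1 s2] := sep Y (subxx _); have := unb _ _ s1 s2.
  rewrite /far_side far // -/(far_side A X) crd //; lia.
have [s1 s2] := sep Z sZY; have sZX := subset_trans sZY sYX.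
by have := unb _ _ s1 s2; rewrite /far_side far // -/(far_side A X) crd //; lia.
Qed.

(** The vertices of [X'] outside [X] all come from the far side. If [A] stopped being small, the far
    side would have dropped below half of [|A|]; moving only [|far_side A X| - |A|] of these
    vertices into the separator would leave two equal sides, which [unbalanced] forbids. *)
Lemma small_side_enlarge (V : finType) (e : rel V) w (A X X' : {set V}) :
  unbalanced e w -> separation e A X -> X \subset X' -> [disjoint A & X'] ->
  #|X'| <= w -> 2 * #|A| < #|far_side A X| -> 2 * #|A| < #|far_side A X'|.
Proof.
move=> unb [dAX nA] sXX' dAX' X'w small; rewrite ltnNge; apply/negP => big.
have sep (Z : {set V}) : X \subset Z -> Z \subset X' -> separation e A Z.
  move=> sXZ sZX'; split; first exact: disjointWr dAX'.
  by move=> u v uA /(nA u v uA); apply: subsetP; apply: setUS.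
have c := card_separation dAX; have c' := card_separation dAX'.
have u' := unb A X' (sep _ sXX' (subxx _)) X'w.
have [|Z sZ cZ] := @exists_subset_card _ (X' :\: X) (#|far_side A X| - #|A|).
  rewrite cardsD (setIidPr sXX'); lia.
have sXZX' : X :|: Z \subset X' by rewrite subUset sXX' (subset_trans sZ) ?subsetDl.
have cXZ : #|X :|: Z| = #|X| + #|Z|.
  rewrite -cardsUI (_ : X :&: Z = set0) ?cards0 ?addn0 //.
  apply/eqP; rewrite setI_eq0; apply: disjointWr sZ _.
  by rewrite disjoints_subset; apply/subsetP => x; rewrite !inE => ->.
have cc := card_separation (disjointWr sXZX' dAX').
have := unb A (X :|: Z) (sep _ (subsetUl _ _) sXZX').
rewrite (leq_trans (subset_leq_card sXZX') X'w) => /(_ isT); lia.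
Qed.

(* The decomposition tree after its nodes outside D have been contracted: h a
   is the set of vertices that lie only in bags contracted into the node a. *)
Record contracted (V T : finType) (e : rel V) (t : rel T) (bag : T -> {set V})
    (D : {set T}) (h : T -> {set V}) : Prop := Contracted {
  contracted_connected : cut_connected t D;
  contracted_arcs : #|arcs t D| <= (#|D|.-1).*2;
  contracted_bag : forall v, cut_connected t [set a in D | v \in bag a];
  contracted_disjoint : forall a b, a \in D -> b \in D -> [disjoint h a & bag b];
  contracted_boundary : forall a u v, a \in D -> u \in h a -> e u v ->
    v \in h a :|: bag a;
  contracted_cover : forall v, exists2 a, a \in D & v \in h a :|: bag a;
  contracted_edge : forall u v, e u v ->
    exists2 a, a \in D & (u \in h a :|: bag a) && (v \in h a :|: bag a);
  contracted_small : forall a, a \in D -> 2 * #|h a| < #|far_side (h a) (bag a)|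
}.

(** A leaf [l] is contracted into its neighbour [p]. The vertices that disappear from the remaining
    bags form [C], and they now hang off [p]. *)
Lemma contract_leaf (V T : finType) (e : rel V) (t : rel T) (bag : T -> {set V})
    w (D : {set T}) (h : T -> {set V}) :
  symmetric t -> irreflexive t -> unbalanced e w -> (forall a, #|bag a| <= w) ->
  1 < #|D| -> contracted e t bag D h ->
  exists2 l, l \in D & exists h', contracted e t bag (D :\ l) h'.
Proof.
move=> tsym tirr unb bagw D2 [con arcsD conv disj bound cover edge small].
have [l [p [lD pD pl tlp leaf]]] := exists_leaf tsym tirr con D2 arcsD.
have pDl : p \in D :\ l by rewrite !inE pl.
(* The nodes whose bags contain [v] are connected, and the only way out of [l] is through [p]. *)
have onlyl v b : v \in bag l -> v \notin bag p -> b \in D -> v \in bag b -> b = l.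
  move=> vl vNp bD vb; apply/eqP; apply: contraT => bl.
  have [|||x [y [/set1P-> yD _ tly]]] := conv v [set l].
  - by rewrite sub1set inE lD.
  - by apply/set0Pn; exists l; rewrite set11.
  - by apply: contraTneq bl => /setP/(_ b); rewrite !inE bD vb => /eqP->; rewrite eqxx.
  by move: yD; rewrite inE => /andP[yD vy]; rewrite -(leaf y yD tly) vy in vNp.
have Dcard : #|D| = #|D :\ l|.+1 by rewrite (cardsD1 l D) lD.
pose C := h l :|: (bag l :\: bag p).
have hlD b : b \in D -> [disjoint h l & bag b] by apply: disj.
have CD b : b \in D :\ l -> [disjoint C & bag b].
  move=> /setD1P[bl bD]; rewrite -setI_eq0 setIUl setU_eq0 !setI_eq0 hlD //=.
  rewrite disjoints_subset; apply/subsetP => v; rewrite !inE => /andP[vNp vl].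
  by apply: contra bl => vb; apply/eqP; apply: onlyl vb.
have CE : C :|: (bag l :&: bag p) = h l :|: bag l.
  by rewrite -setUA [_ :\: _ :|: _]setUC setID.
have subl : h l :|: bag l \subset C :|: bag p.
  by rewrite -CE setUS // subsetIr.
(* A vertex of [bag l] outside [bag p] lies in no other remaining bag, nor in any [h a], as these
   are disjoint from [bag l]. So its edges are all covered at [l]. *)
have Cnbr u v : u \in C -> e u v -> v \in h l :|: bag l.
  rewrite {1}/C in_setU => /orP[ul|]; first exact: bound.
  move=> /setDP[ul uNp] /edge[a aD /andP[ua va]].
  suff <- : a = l by [].
  move: ua; rewrite inE => /orP[ua|ua]; last exact: onlyl ul uNp aD ua.
  by have /disjointFr/(_ ua) := disj a l aD lD; rewrite ul.
(* Start from the small side [h l] of the separator [bag l], absorb [bag l :\: bag p], then enlarge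
   the separator to [bag p]. *)
have Csmall : 2 * #|C| < #|far_side C (bag p)|.
  have sepC : separation e C (bag l :&: bag p).
    split; first by apply: disjointWr (CD p pDl); apply: subsetIr.
    by move=> u v uC /(Cnbr u v uC); rewrite CE.
  apply: (small_side_enlarge unb sepC (subsetIr _ _) (CD p pDl) (bagw p)).
  rewrite (_ : bag l :&: bag p = bag l :\: (bag l :\: bag p)); last by rewrite setDDr setDv set0U.
  apply: (small_side_absorb unb _ (bagw l) (subsetDl _ _) _ (small l lD)).
    by split; [apply: hlD|move=> u v; apply: bound].
  by move=> u v uD; apply: Cnbr; rewrite /C in_setU uD orbT.
pose h' a := if a == p then h p :|: C else h a.
have subp : h p :|: bag p \subset h' p :|: bag p.
  by rewrite /h' eqxx setSU // subsetUl.
have sublp : h l :|: bag l \subset h' p :|: bag p.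
  by apply: subset_trans subl _; rewrite /h' eqxx setSU // subsetUr.
have push a : a \in D -> exists2 b, b \in D :\ l & h a :|: bag a \subset h' b :|: bag b.
  move=> aD; have [->|al] := eqVneq a l; first by exists p.
  have [->|ap] := eqVneq a p; first by exists p.
  by exists a; rewrite ?inE ?al // /h' (negPf ap).
exists l => //; exists h'; split.
- exact: cut_connectedD1 leaf con.
- have := card_arcsD1 tsym lD pD pl tlp; have := cardsD1 p (D :\ l); rewrite pDl; lia.
- move=> v; rewrite (_ : [set a in _ | _] = [set a in D | v \in bag a] :\ l).
    by apply: (@cut_connectedD1 _ _ _ l p) => // y; rewrite inE => /andP[yD _]; apply: leaf.
  by apply/setP => a; rewrite !inE andbA.
- move=> a b /setD1P[al aD] bDl; have /setD1P[bl bD] := bDl.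
  rewrite /h'; case: eqP => _; last exact: disj.
  by rewrite -setI_eq0 setIUl setU_eq0 !setI_eq0 disj ?CD.
- move=> a u v /setD1P[al aD]; rewrite {1}/h'; case: (a =P p) => [->|/eqP ap].
    rewrite in_setU => /orP[/bound|/Cnbr] /[apply]; last exact: (subsetP sublp).
    by move=> /(_ pD); apply: (subsetP subp).
  by rewrite /h' (negPf ap); apply: bound.
- move=> v; have [a aD va] := cover v; have [b bD sab] := push a aD.
  by exists b => //; apply: (subsetP sab).
- move=> u v /edge[a aD /andP[ua va]]; have [b bD sab] := push a aD.
  by exists b => //; rewrite !(subsetP sab).
- move=> a /setD1P[al aD]; rewrite /h'; case: (a =P p) => [->|_]; last exact: small.
  have dis : [disjoint h p :|: C & bag p].
    by rewrite -setI_eq0 setIUl setU_eq0 !setI_eq0 disj ?CD.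
  have sep : separation e (h p :|: C) (bag p).
    split=> // u v; rewrite in_setU => /orP[/bound|/Cnbr] /[apply].
      by move=> /(_ pD); apply: subsetP; rewrite setSU // subsetUl.
    by move/(subsetP subl); apply: subsetP; rewrite setSU // subsetUr.
  (* The ratio 2 matters here: [h p] and [C] are each less than a third of the complement of
     [bag p], so their union is less than two thirds of it and cannot be the large side. *)
  have := unb _ _ sep (bagw p).
  have := card_separation dis; have := card_separation (disj p p pD pD).
  have := card_separation (CD p pDl); have := small p pD; have := cardsU (h p) C.
  lia.
Qed.

(** Contract leaves until one node [r] remains. Then [h r] and [bag r] cover every vertex, so the
    far side is empty and [h r] cannot be small. *)
Lemma contracted_balanced (V T : finType) (e : rel V) (t : rel T)
    (bag : T -> {set V}) w (D : {set T}) (h : T -> {set V}) :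
  symmetric t -> irreflexive t -> (forall a, #|bag a| <= w) -> D != set0 ->
  contracted e t bag D h -> ~ unbalanced e w.
Proof.
move=> tsym tirr bagw + + unb; have [m] := ubnP #|D|.
elim: m D h => // m IH D h Dm D0 ct.
have [D2|D1] := ltnP 1 #|D|.
  have [l lD [h' ct']] := contract_leaf tsym tirr unb bagw D2 ct.
  have := cardsD1 l D; rewrite lD => cD.
  by apply: IH ct'; [lia|rewrite -card_gt0; lia].
have [r rD] := set0Pn _ D0; have := contracted_small ct rD.
rewrite (_ : far_side _ _ = set0) ?cards0 //; apply/setP => v.
have [a aD va] := contracted_cover ct v.
by rewrite in_set0 in_setC (card_le1_eqP D1 a r aD rD) va.
Qed.

Lemma balanced_separation n (e : rel 'I_n) k : has_td_width_le e k -> k.+1 < n ->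
  exists A X : {set 'I_n}, [/\ separation e A X, #|X| <= k.+1,
    #|far_side A X| <= 2 * #|A| & #|A| <= 2 * #|far_side A X|].
Proof.
move=> [m [t [bag [[[m0 tsym tirr tcon tarcs] cover edge conn] bagk]]]] kn.
apply: NNPP => nbal; case: (@contracted_balanced _ _ e t bag k.+1 setT (fun=> set0)) => //.
- by rewrite -card_gt0 cardsT card_ord.
- split.
  + apply: connect_cut_connected => a b _ _.
    by rewrite (@eq_connect _ _ t) // => x y; rewrite /= !inE !andbT.
  + by rewrite cardsT card_ord -tarcs; apply: eq_leq; apply: eq_card => p; rewrite !inE.
  + move=> v; apply: connect_cut_connected => a b; rewrite !inE => va vb.
    rewrite (eq_connect (e' := [rel x y | [&& t x y, v \in bag x & v \in bag y]])).
      exact: conn.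
    by move=> x y; rewrite /= !inE.
  + by move=> a b _ _; rewrite -setI_eq0 set0I.
  + by move=> a u v _; rewrite inE.
  + by move=> v; have [a va] := cover v; exists a; rewrite ?inE // va orbT.
  + move=> u v /edge[a /andP[ua va]].
    by exists a; rewrite ?inE // ua va !orbT.
  (* The empty side is small exactly when the bag misses some vertex, which holds as [k.+1 < n]. *)
  + move=> a _ /=; rewrite cards0 muln0.
    have := @card_separation _ (set0 : {set 'I_n}) (bag a).
    rewrite -setI_eq0 set0I eqxx card_ord cards0 => /(_ isT) nE.
    by rewrite -(ltn_add2l #|bag a|) -[X in _ < X]add0n addnA nE addn0 (leq_ltn_trans (bagk a)).
- move=> A X sep Xk; have [s1|s1] := leqP #|far_side A X| (2 * #|A|); last by left.
  have [s2|s2] := leqP #|A| (2 * #|far_side A X|); last by right.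
  by case: nbal; exists A, X.
Qed.

(** [epsilon] meets its specification only once a least width is known to exist. A single bag with
    all vertices shows that [n] is an admissible bound, and classical descent reaches a least
    one. *)
Lemma treewidthP n (e : rel 'I_n) : has_td_width_le e (treewidth e).
Proof.
have td_n : has_td_width_le e n.
  exists 1, (fun _ _ => false), (fun=> setT); split; last first.
    by move=> _; rewrite cardsT card_ord.
  split.
  - split=> //; first by move=> a b; rewrite !ord1 connect0.
    by apply/eqP; rewrite cards_eq0; apply/eqP/setP => p; rewrite !inE.
  - by move=> v; exists ord0; rewrite inE.
  - by move=> u v _; exists ord0; rewrite !inE.
  - by move=> v a b _ _; rewrite !ord1 connect0.
have [k [tdk mink]] : exists k, has_td_width_le e k /\
    forall j, has_td_width_le e j -> k <= j.
  have [m] := ubnP n; move: td_n; move: {2 3}n => k.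
  elim: m k => // m IH k tdk km.
  have [[j [tdj jk]]|nj] := classic (exists j, has_td_width_le e j /\ j < k).
    by apply: (IH j tdj); lia.
  exists k; split=> // j tdj; rewrite leqNgt; apply/negP => jk.
  by apply: nj; exists j.
rewrite /treewidth; set P := (fun k : nat => _ /\ _).
by have [] := ClassicalEpsilon.epsilon_spec (inhabits 0) P (ex_intro _ k (conj tdk mink)).
Qed.

(** * Rayleigh quotients of real symmetric matrices *)

Local Open Scope ring_scope.
Local Open Scope sesquilinear_scope.

Lemma char_poly_conj (F : fieldType) n (P A : 'M[F]_n) :
  P \in unitmx -> char_poly (invmx P *m A *m P) = char_poly A.
Proof.
move=> Pu; have PV : map_mx polyC (invmx P) *m map_mx polyC P = 1%:M.
  by rewrite -map_mxM mulVmx // map_mx1.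
have XP : 'X%:M = map_mx polyC (invmx P) *m 'X%:M *m map_mx polyC P.
  by rewrite scalar_mxC -mulmxA PV mulmx1.
rewrite /char_poly /char_poly_mx !map_mxM {1}XP -mulmxBl -mulmxBr !det_mulmx.
by rewrite mulrAC -det_mulmx PV det1 mul1r.
Qed.

(** Over [R[i]] the matrix is Hermitian, so the spectral theorem applies and the eigenvalues are
    real. Comparing the two factorizations of the characteristic polynomial identifies them with [s]
    up to order. *)
Lemma symmetric_diagonalization (R : rcfType) n (A : 'M[R]_n) (s : seq R) :
  A^T = A -> char_poly A = \prod_(x <- s) ('X - x%:P) ->
  exists (mu : 'I_n -> R) (U : 'M[R[i]]_n),
    [/\ perm_eq [seq mu i | i <- enum 'I_n] s, U \is unitarymx &
        map_mx (real_complex R) A =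
          U ^t* *m diag_mx (\row_i (mu i)%:C%C) *m U].
Proof.
move=> Asym Achar; pose B := map_mx (real_complex R) A.
have Breal : B \is a realmx by apply/mxOverP => i j; rewrite mxE complex_real.
have Bherm : B \is hermsymmx.
  apply: realsym_hermsym => //; apply/is_hermitianmxP.
  by rewrite expr0 scale1r map_mx_id // map_trmx Asym.
have /orthomx_spectralP BE := hermitian_normalmx Bherm.
have Dreal := mxOverP (hermitian_spectral_diag_real Bherm).
pose mu i := complex.Re (spectral_diag B 0 i).
have DE : spectral_diag B = \row_i (mu i)%:C%C.
  by apply/rowP => i; rewrite mxE RRe_real.
exists mu, (spectralmx B); split; last 2 first.
- exact: spectral_unitarymx.
- by rewrite -DE -invmx_unitary ?spectral_unitarymx.
have : char_poly B = \prod_(x <- [seq x%:C%C | x <- s]) ('X - x%:P).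
  rewrite -map_char_poly Achar rmorph_prod big_map; apply: eq_bigr => x _.
  by rewrite rmorphB /= map_polyX map_polyC.
rewrite BE char_poly_conj ?spectral_unit // char_poly_trig ?diag_mx_is_trig //.
rewrite (_ : \prod_(i < n) _ = \prod_(x <- [seq (mu i)%:C%C | i <- enum 'I_n]) ('X - x%:P)).
  move=> /prod_XsubC_eq; rewrite (map_comp (real_complex R)).
  by apply: perm_map_inj; apply: complexI.
rewrite big_map enumT; apply: eq_bigr => i _.
by rewrite {1}DE !mxE eqxx.
Qed.

(** Here [c x] lists the coordinates of [x] in a unitary eigenbasis. Parseval's identity and the
    diagonal action of [A] reduce Rayleigh bounds to termwise comparisons. *)
Lemma eigen_coordinates (R : rcfType) n (A : 'M[R]_n) (s : seq R) :
  A^T = A -> char_poly A = \prod_(x <- s) ('X - x%:P) ->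
  exists (mu : 'I_n -> R) (W : 'M[R[i]]_n),
    let c (x : 'rV[R]_n) := map_mx (real_complex R) x *m W in
    [/\ perm_eq [seq mu i | i <- enum 'I_n] s,
        forall x y, ((x *m y^T) 0 0)%:C%C = \sum_i c x 0 i * (c y 0 i)^* &
        forall x i, c (x *m A) 0 i = (mu i)%:C%C * c x 0 i].
Proof.
move=> Asym /(symmetric_diagonalization Asym)[mu [U [mu_s /unitarymxP UU AE]]].
exists mu, (U ^t*) => c; split=> // [x y|x i].
  have -> : ((x *m y^T) 0 0)%:C%C = (c x *m (c y) ^t*) 0 0.
    rewrite trmx_mul map_mxM trmxCK mulmxA -(mulmxA _ (U ^t*)) (mulmx1C UU) mulmx1.
    have -> : (map_mx (real_complex R) y) ^t* = map_mx (real_complex R) y^T.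
      by apply/matrixP => j k; rewrite !mxE conj_Creal ?complex_real.
    by rewrite -(map_mxM (real_complex R)) [RHS]mxE.
  by rewrite mxE; apply: eq_bigr => j _; rewrite !mxE.
rewrite /c map_mxM AE !mulmxA -(mulmxA _ U) UU mulmx1 mul_mx_diag mxE mulrC.
by rewrite [in X in X * _]mxE.
Qed.

Lemma rayleigh_le_max (R : rcfType) n (A : 'M[R]_n) (s : seq R) (M : R) (h : 'rV[R]_n) :
  A^T = A -> char_poly A = \prod_(x <- s) ('X - x%:P) ->
  (forall x, x \in s -> x <= M) ->
  (h *m A *m h^T) 0 0 <= M * (h *m h^T) 0 0.
Proof.
move=> Asym Achar sM.
have [mu [W]] := eigen_coordinates Asym Achar; set c := (fun _ => _) => /= -[mu_s cdot cA].
rewrite -lecR rmorphM /= !cdot mulr_sumr; apply: ler_sum => i _.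
rewrite cA -mulrA ler_wpM2r ?mul_conjC_ge0 // lecR sM //.
by rewrite -(perm_mem mu_s) map_f // mem_enum.
Qed.

(** A count is invariant under permutation, so this transfers to the unordered family [mu]: at most
    one index has an eigenvalue below the second entry. *)
Lemma sorted_count_lt_second (R : realDomainType) (s : seq R) :
  sorted <=%R s -> (count (fun x => x < s`_1)%R s <= 1)%N.
Proof.
case: s => [|a [|b s]] //=; first by rewrite addn0 leq_b1.
rewrite le_path_sortedE ?ltxx => /andP[_ /andP[/allP bs _]].
suff -> : count (fun x => x < b)%R s = 0%N by rewrite !addn0 leq_b1.
by apply/eqP; rewrite -leqn0 leqNgt -has_count; apply/hasPn => x /bs; rewrite -leNgt.
Qed.

(* As s`_1 > 0, the null vector v is supported on the only eigenvector of
   eigenvalue below s`_1, so that h has no component along it. *)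
Lemma rayleigh_ge_second (R : rcfType) n (A : 'M[R]_n) (s : seq R) (h v : 'rV[R]_n) :
  A^T = A -> char_poly A = \prod_(x <- s) ('X - x%:P) -> sorted <=%R s ->
  0 < s`_1 -> v *m A = 0 -> (v *m v^T) 0 0 != 0 -> (h *m v^T) 0 0 = 0 ->
  s`_1 * (h *m h^T) 0 0 <= (h *m A *m h^T) 0 0.
Proof.
move=> Asym Achar ssort s1 vA0 v0 hv.
have [mu [W]] := eigen_coordinates Asym Achar; set c := (fun _ => _) => /= -[mu_s cdot cA].
have cv0 i : mu i != 0 -> c v 0 i = 0.
  move=> mui; have := cA v i; rewrite vA0 {1}/c map_mx0 mul0mx mxE.
  by move=> /esym/eqP; rewrite mulf_eq0 (fmorph_eq0 (real_complex R)) (negPf mui) => /eqP.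
have [i0 cvi0] : exists i, c v 0 i != 0.
  apply/existsP; apply: contraNT v0 => /existsPn cv.
  rewrite -(fmorph_eq0 (real_complex R)) /= cdot big1 // => i _.
  by have := cv i; rewrite negbK => /eqP->; rewrite mul0r.
have mui0 : mu i0 = 0 by apply/eqP; apply: contraNT cvi0 => /cv0->.
have mu_ge j : j != i0 -> s`_1 <= mu j.
  move=> ji0; rewrite leNgt; apply/negP => muj.
  have := sorted_count_lt_second ssort; rewrite leqNgt => /negP; apply.
  rewrite -(permP mu_s) count_map -size_filter.
  apply: (@uniq_leq_size _ [:: i0; j]); first by rewrite /= inE eq_sym ji0.
  by move=> k; rewrite !inE mem_filter mem_enum andbT => /orP[]/eqP->; rewrite /= ?mui0.
have chi0 : c h 0 i0 = 0.
  have := cdot h v; rewrite hv rmorph0 (bigD1 i0) //= big1 ?addr0.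
    by move=> /esym/eqP; rewrite mulf_eq0 conjC_eq0 (negPf cvi0) orbF => /eqP.
  move=> j ji0; rewrite (cv0 j) ?rmorph0 ?mulr0 //.
  by rewrite gt_eqF // (lt_le_trans s1) ?mu_ge.
rewrite -lecR rmorphM /= !cdot mulr_sumr; apply: ler_sum => i _.
have [->|ii0] := eqVneq i i0; first by rewrite chi0 !mul0r mulr0 cA chi0 mulr0 mul0r.
by rewrite cA -mulrA ler_wpM2r ?mul_conjC_ge0 // lecR mu_ge.
Qed.

(** * Energy of a separation *)

Lemma laplacian_sym (R : realType) n (e : rel 'I_n) :
  symmetric e -> (laplacian R e)^T = laplacian R e.
Proof.
by move=> esym; apply/matrixP => i j; rewrite !mxE eq_sym esym; case: eqP => // ->.
Qed.

Lemma laplacian_const (R : realType) n (e : rel 'I_n) :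
  simple_graph e -> (const_mx 1 : 'rV[R]_n) *m laplacian R e = 0.
Proof.
move=> [esym eirr]; apply/rowP => j; rewrite !mxE (bigD1 j) //= !mxE eqxx mul1r.
rewrite (eq_bigr (fun i => if e i j then -1 else 0)); last first.
  by move=> i ij; rewrite !mxE mul1r (negPf ij).
rewrite -big_mkcondr /= sumr_const mulNrn; apply/eqP; rewrite subr_eq0; apply/eqP.
congr (_%:R); apply: eq_card => i; rewrite !inE unfold_in esym.
by case: eqP => // ->; rewrite eirr.
Qed.

Definition indicator (R : realType) n (A : {set 'I_n}) : 'rV[R]_n :=
  \row_i (i \in A)%:R.

Lemma indicator_dot (R : realType) n (A B : {set 'I_n}) :
  (indicator R A *m (indicator R B)^T) 0 0 = #|A :&: B|%:R.
Proof.
rewrite mxE -sum1_card natr_sum [RHS]big_mkcond /=; apply: eq_bigr => i _.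
by rewrite !mxE inE; case: (i \in A); case: (i \in B); rewrite ?mulr1 ?mulr0 ?mul0r.
Qed.

Lemma laplacian_indicator_far (R : realType) n (e : rel 'I_n) (A X : {set 'I_n}) :
  separation e A X ->
  indicator R A *m laplacian R e *m (indicator R (far_side A X))^T = 0.
Proof.
move=> [_ nA]; apply/matrixP => i j; rewrite !mxE big1 // => v _.
rewrite !mxE; have [vB|] := boolP (v \in far_side A X); last by rewrite mulr0.
rewrite mulr1 big1 // => u _; rewrite !mxE.
have [uA|] := boolP (u \in A); last by rewrite mul0r.
rewrite mul1r; move: vB; rewrite inE => vB.
case: eqP => [uv|_]; first by rewrite -uv inE uA in vB.
by case: ifP => // /(nA u v uA); rewrite (negPf vB).
Qed.

Definition energy (R : realType) n (e : rel 'I_n) (x : 'rV[R]_n) : R :=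
  (x *m laplacian R e *m x^T) 0 0.

Lemma energy_sub_const (R : realType) n (e : rel 'I_n) (x : 'rV[R]_n) (c : R) :
  simple_graph e -> energy e (x - c *: const_mx 1) = energy e x.
Proof.
move=> eg; have L1 := laplacian_const R eg; have [esym _] := eg.
have L1' : laplacian R e *m (const_mx 1 : 'rV[R]_n)^T = 0.
  by rewrite -[laplacian R e]laplacian_sym // -trmx_mul L1 trmx0.
rewrite /energy mulmxBl -scalemxAl L1 scaler0 subr0 linearB linearZ /= mulmxBr.
by rewrite -scalemxAr -mulmxA -mulmxA L1' mulmx0 scaler0 subr0.
Qed.

(* No edge joins the two sides, so flipping the sign on one of them does not change the energy. *)
Lemma energy_flip (R : realType) n (e : rel 'I_n) (A X : {set 'I_n}) :
  symmetric e -> separation e A X ->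
  energy e (indicator R A - indicator R (far_side A X)) =
  energy e (indicator R A + indicator R (far_side A X)).
Proof.
move=> esym sep; have fg := laplacian_indicator_far R sep.
rewrite /energy; set f := indicator R A in fg *; set g := indicator _ _ in fg *.
have gf : g *m laplacian R e *m f^T = 0.
  by apply: trmx_inj; rewrite !trmx_mul trmxK laplacian_sym // mulmxA fg trmx0.
rewrite !linearB !linearD /= ?mulmxBl ?mulmxDl ?mulmxBr ?mulmxDr fg gf.
by rewrite !subr0 !sub0r opprK !addr0 !add0r.
Qed.

Lemma dotE (R : realType) n (x y : 'rV[R]_n) :
  (x *m y^T) 0 0 = \sum_i x 0 i * y 0 i.
Proof. by rewrite mxE; apply: eq_bigr => i _; rewrite mxE. Qed.

(** The variance identity, for a vector with coordinate sum [t] and squared norm [q]. *)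
Lemma dot_sub_mean (R : realType) n (x : 'rV[R]_n) (t q : R) : (0 < n)%N ->
  (x *m (const_mx 1 : 'rV[R]_n)^T) 0 0 = t -> (x *m x^T) 0 0 = q ->
  let y := x - (t / n%:R) *: const_mx 1 in
  (y *m (const_mx 1 : 'rV[R]_n)^T) 0 0 = 0 /\ (y *m y^T) 0 0 = q - t ^+ 2 / n%:R.
Proof.
move=> n0; have nn0 : n%:R != 0 :> R by rewrite pnatr_eq0 -lt0n.
rewrite !dotE => xt xq /=; set c := t / n%:R; rewrite !dotE; split.
  rewrite -[RHS](subrr t) -{1}xt -[X in _ = _ - X](divfK nn0) -/c mulr_natr.
  rewrite -[X in c *+ X]card_ord -sumr_const -sumrB.
  by apply: eq_bigr => i _; rewrite !mxE !mulr1.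
have -> : q - t ^+ 2 / n%:R = q - 2 * c * t + c ^+ 2 *+ n.
  by rewrite -mulr_natr /c; field.
have <- : \sum_(i < n) c ^+ 2 = c ^+ 2 *+ n by rewrite sumr_const card_ord.
rewrite -xq -xt mulr_sumr -sumrB -big_split /=.
by apply: eq_bigr => i _; rewrite !mxE; ring.
Qed.

Lemma lap_spectrum_size (R : realType) n (e : rel 'I_n) (s : seq R) :
  lap_spectrum e s -> size s = n.
Proof.
move=> [_ /(congr1 (fun p : {poly R} => size p))].
by rewrite size_char_poly size_prod_XsubC => -[].
Qed.

Lemma lap_spectrum_le_last (R : realType) n (e : rel 'I_n) (s : seq R) x :
  lap_spectrum e s -> x \in s -> x <= s`_n.-1.
Proof.
move=> sp xs; have [ssort _] := sp; have sn := lap_spectrum_size sp.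
have := xs; rewrite -index_mem sn => i_n; rewrite -(nth_index 0 xs).
have n0 : (0 < n)%N by apply: leq_ltn_trans i_n.
by apply: (sorted_leq_nth le_trans le_refl); rewrite ?inE ?sn ?ltn_predL // -ltnS prednK.
Qed.

Lemma lap_spectrum_0 (R : realType) n (e : rel 'I_n) (s : seq R) :
  (0 < n)%N -> simple_graph e -> lap_spectrum e s -> 0 \in s.
Proof.
move=> n0 eg [_ Lchar]; rewrite -root_prod_XsubC -Lchar -eigenvalue_root_char.
apply/eigenvalueP; exists (const_mx 1); first by rewrite laplacian_const // scale0r.
by apply/eqP => /rowP/(_ (Ordinal n0)); rewrite !mxE => /eqP; rewrite oner_eq0.
Qed.

Lemma separation_energy_bound (R : realType) n (e : rel 'I_n) (s : seq R)
    (A X : {set 'I_n}) :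
  let a := #|A|%:R : R in let b := #|far_side A X|%:R in
  simple_graph e -> lap_spectrum e s -> (0 < n)%N -> 0 < s`_1 -> separation e A X ->
  s`_1 * ((a + b) - (a - b) ^+ 2 / n%:R) <=
  s`_n.-1 * ((a + b) - (a + b) ^+ 2 / n%:R).
Proof.
move=> a b eg sp n0 s1 sep; have [esym _] := eg; have [ssort Lchar] := sp.
have [dAX _] := sep; have Lsym := laplacian_sym R esym.
set f := indicator R A; set g := indicator R (far_side A X).
have f1 C : (indicator R C *m (const_mx 1 : 'rV[R]_n)^T) 0 0 = #|C|%:R.
  have -> : const_mx 1 = indicator R [set: 'I_n] by apply/rowP => i; rewrite !mxE inE.
  by rewrite indicator_dot setIT.
have AB : A :&: far_side A X = set0.
  by apply/setP => v; rewrite !inE; case: (v \in A).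
have ff : (f *m f^T) 0 0 = a by rewrite indicator_dot setIid.
have gg : (g *m g^T) 0 0 = b by rewrite indicator_dot setIid.
have fg : (f *m g^T) 0 0 = 0 by rewrite indicator_dot AB cards0.
have gf : (g *m f^T) 0 0 = 0 by rewrite indicator_dot setIC AB cards0.
have mxBE (M N : 'M[R]_1) : (M - N) 0 0 = M 0 0 - N 0 0 by rewrite !mxE.
have mxDE (M N : 'M[R]_1) : (M + N) 0 0 = M 0 0 + N 0 0 by rewrite !mxE.
(* The sides are disjoint, so [f - g] and [f + g] both have squared norm [a + b]; only their
   coordinate sums differ. *)
have [||h1 hh] := @dot_sub_mean R n (f - g) (a - b) (a + b) n0.
- by rewrite mulmxBl mxBE !f1.
- by rewrite linearB /= mulmxBl !mulmxBr !mxBE ff gg fg gf; ring.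
have [||_ kk] := @dot_sub_mean R n (f + g) (a + b) (a + b) n0.
- by rewrite mulmxDl mxDE !f1.
- by rewrite linearD /= mulmxDl !mulmxDr !mxDE ff gg fg gf; ring.
rewrite -hh -kk.
apply: le_trans (rayleigh_ge_second Lsym Lchar ssort s1 (laplacian_const R eg) _ h1) _.
  rewrite dotE (eq_bigr (fun=> 1)) => [|i _]; last by rewrite !mxE mulr1.
  by rewrite sumr_const card_ord pnatr_eq0 -lt0n.
apply: le_trans (rayleigh_le_max _ Lsym Lchar (fun x => lap_spectrum_le_last sp)).
by rewrite -!/(energy e _) !energy_sub_const // energy_flip.
Qed.

(** * The final inequality *)

Lemma balanced_energy_arith (R : realFieldType) (a b x w l2 ln : R) :
  0 < l2 -> l2 <= ln -> 0 < a + b -> 0 <= x -> x <= w -> a <= 2 * b -> b <= 2 * a ->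
  l2 * (a + b - (a - b) ^+ 2 / (a + x + b)) <=
    ln * (a + b - (a + b) ^+ 2 / (a + x + b)) ->
  2 * (a + x + b) * l2 <= w * (3 * ln - l2).
Proof.
move=> l2p l2n m0 x0 xw ab ba.
have n_gt0 : 0 < a + x + b by lra.
have nn0 : a + x + b != 0 by rewrite gt_eqF.
rewrite -(ler_pM2r n_gt0).
have -> : l2 * (a + b - (a - b) ^+ 2 / (a + x + b)) * (a + x + b) =
    l2 * ((a + b) * (a + x + b) - (a - b) ^+ 2) by field.
have -> : ln * (a + b - (a + b) ^+ 2 / (a + x + b)) * (a + x + b) =
    (a + b) * (ln * x) by field.
move=> bound.
(* The difference of the two sides is [4 (2b - a) (2a - b)]. *)
have bal : 9 * (a - b) ^+ 2 <= (a + b) ^+ 2.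
  have : 0 <= (2 * b - a) * (2 * a - b) by apply: mulr_ge0; lra.
  lra.
have key : l2 * (8 * (a + b) + 9 * x) <= 9 * (ln * x).
  rewrite -(ler_pM2l m0).
  have := ler_wpM2l (ltW l2p) bal; lra.
(* This replaces [x] by its upper bound [w]. The positive term [l2 * (a + b)] absorbs what [key]
   gives in excess. *)
have slack : 0 <= (w - x) * (3 * ln - l2) by apply: mulr_ge0; lra.
have : 0 < l2 * (a + b) by apply: mulr_gt0.
lra.
Qed.

Theorem theorem2 (R : realType) (n : nat) (e : rel 'I_n) (s : seq R) :
  simple_graph e ->
  (exists u v, e u v) ->
  lap_spectrum e s ->
  ((2 * n%:R * s`_1) / (3 * s`_(n.-1) - s`_1) - 1 <= (treewidth e)%:R)%R.
Proof.
move=> eg [u [v euv]] sp; have [_ eirr] := eg.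
(* With two vertices, the entry of index 1 in [s] is a genuine eigenvalue and not the default 0 of
   [nth]. *)
have n2 : (1 < n)%N.
  have uv : u != v by apply: contraTneq euv => ->; rewrite eirr.
  by move: uv; rewrite -val_eqE /=; have := ltn_ord u; have := ltn_ord v; lia.
have n0 := ltnW n2.
set l2 := s`_1; set ln := s`_n.-1; set k := treewidth e.
have ln0 : 0 <= ln by exact: (lap_spectrum_le_last sp (lap_spectrum_0 n0 eg sp)).
have l2n : l2 <= ln.
  by apply: (lap_spectrum_le_last sp); rewrite mem_nth // (lap_spectrum_size sp).
have den0 : 0 <= 3 * ln - l2 by lra.
rewrite lerBlDr.
(* For nonpositive [l2] the quotient is nonpositive, even if its denominator vanishes, since then
   the inverse is 0. *)
have [l20|l2p] := leP l2 0.
  apply: (@le_trans _ _ 0); last by rewrite addr_ge0.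
  by rewrite mulr_le0_ge0 ?invr_ge0 // mulr_ge0_le0 ?mulr_ge0.
rewrite ler_pdivrMr; last by lra.
have k0 : 0 <= k%:R :> R by [].
have [nk|kn] := leqP n k.+1.
  have nk' : n%:R <= k%:R + 1 :> R by rewrite natr1 ler_nat.
  have nn0 : 0 <= n%:R :> R by [].
  nra.
have [A [X [sep Xk b2a a2b]]] := balanced_separation (treewidthP e) kn.
have bound := separation_energy_bound eg sp n0 l2p sep; move: bound.
have nE := card_separation (proj1 sep); rewrite card_ord in nE.
set a := #|A| in nE a2b b2a *; set b := #|far_side A X| in nE a2b b2a *.
set x := #|X| in nE Xk; rewrite -/l2 -/ln.
have nE' : n%:R = a%:R + x%:R + b%:R :> R by rewrite -nE !natrD.
rewrite nE'; apply: balanced_energy_arith => //.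
- by rewrite -natrD ltr0n; lia.
- by rewrite natr1 ler_nat.
- by rewrite -natrM ler_nat.
- by rewrite -natrM ler_nat.
Qed.
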